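(* Let $U=\{1,\dots,n\}$ with metric $d$, and assume $p_i=p\in[0,1]$ for all $i\in U$. Then the distance-greedy algorithm provides a $\frac12$-approximation guarantee for MaxSSD. That is, for any ordering $S$ of $U$ output by the algorithm, $$\mathcal{S}_+(S)\ \ge\ \tfrac12\max_{O}\mathcal{S}_+(O),$$ the maximum being over all orderings $O$ of $U$.
   Context: For an ordering $O=(\pi(1),\dots,\pi(n))$ of $U$ let $O_k=(\pi(1),\dots,\pi(k))$. A user examines items in order; on examining $\pi(i)$ the user, independently with probability $p_{\pi(i)}$, accepts it and continues, and otherwise quits without accepting it. Let $A$ be the random prefix of accepted items: $\Pr(A=O_k)=\prod_{i=1}^kp_{\pi(i)}(1-p_{\pi(k+1)})$ for $0\le k\le n-1$ and $\Pr(A=O_n)=\prod_{i=1}^np_{\pi(i)}$. For a set (or sequence) $S$ of items let $\mathrm{Div}(S)=\sum_{\{i,j\}\subseteq S,\,i\neq j}d(i,j)$, each unordered pair being counted once. The sequential sum diversity is $\mathcal{S}_+(O)=\mathbb{E}_A[\mathrm{Div}(A)]$; MaxSSD asks for an ordering of $U$ maximizing $\mathcal{S}_+$. Distance-greedy algorithm: start with the empty sequence $S$; while $|S|<n$, append to $S$ an item $u\in U\setminus S$ maximizing $\mathrm{Div}(S\cup\{u\})$ (ties broken arbitrarily). Output the resulting ordering $S$. *)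

(* Defs.v *)
From HB Require Import structures.
From mathcomp Require Import all_boot all_order all_algebra.

Set Implicit Arguments.
Unset Strict Implicit.
Unset Printing Implicit Defensive.

Import Order.TTheory GRing.Theory Num.Theory.
Local Open Scope ring_scope.

Definition is_metric (R : realFieldType) (T : Type) (d : T -> T -> R) : Prop :=
  [/\ forall x y, 0 <= d x y,
      forall x y, d x y = 0 <-> x = y,
      forall x y, d x y = d y x
    & forall x y z, d x z <= d x y + d y z].

(* Each unordered pair {i, j} is enumerated once, with i < j as numbers. *)
Definition Div (R : realFieldType) (n : nat) (d : 'I_n -> 'I_n -> R)
    (A : {set 'I_n}) : R :=
  \sum_(i in A) \sum_(j in A | (i < j)%N) d i j.

(* An ordering of 'I_n is a duplicate-free sequence containing every item. *)
Definition orderings (n : nat) : seq (seq 'I_n) := permutations (enum 'I_n).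

(* Probability that the accepted prefix of O is exactly [take k O]: the first k
   items are accepted, and the next one, if there is any, is rejected. *)
Definition prefix_prob (R : realFieldType) (n : nat) (p : 'I_n -> R)
    (O : seq 'I_n) (k : nat) : R :=
  (\prod_(i <- take k O) p i) *
  (if drop k O is j :: _ then 1 - p j else 1).

Definition seq_sum_diversity (R : realFieldType) (n : nat)
    (d : 'I_n -> 'I_n -> R) (p : 'I_n -> R) (O : seq 'I_n) : R :=
  \sum_(k < (size O).+1) prefix_prob p O k * Div d [set i in take k O].

(* The seed of the iterated maximum is the value at the ordering (0, .., n-1),
   so this is exactly the maximum of the finitely many values. *)
Definition max_seq_sum_diversity (R : realFieldType) (n : nat)
    (d : 'I_n -> 'I_n -> R) (p : 'I_n -> R) : R :=
  \big[Num.max/seq_sum_diversity d p (enum 'I_n)]_(O <- orderings n)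
     seq_sum_diversity d p O.

(* Sequences reachable by the loop; being an inductive relation, it allows every
   way of breaking ties, including the arbitrary choice of the first item. *)
Inductive greedy_run (R : realFieldType) (n : nat) (d : 'I_n -> 'I_n -> R) :
    seq 'I_n -> Prop :=
| greedy_start : greedy_run d [::]
| greedy_append (s : seq 'I_n) (u : 'I_n) :
    greedy_run d s ->
    (size s < n)%N ->
    u \notin s ->
    (forall v, v \notin s ->
       Div d (v |: [set i in s]) <= Div d (u |: [set i in s])) ->
    greedy_run d (rcons s u).

Definition greedy_output (R : realFieldType) (n : nat) (d : 'I_n -> 'I_n -> R)
    (s : seq 'I_n) : Prop :=
  greedy_run d s /\ ~~ (size s < n)%N.

Lemma mem_orderings (n : nat) (s : seq 'I_n) :
  (s \in orderings n) = uniq s && (size s == n).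
Proof.
rewrite mem_permutations; apply/idP/andP => [sP|[su /eqP sn]].
  by rewrite (perm_uniq sP) (perm_size sP) enum_uniq size_enum_ord.
rewrite uniq_perm ?enum_uniq //.
have sub : {subset s <= enum 'I_n} by move=> i _; rewrite mem_enum.
by have [] := uniq_min_size su sub; rewrite ?size_enum_ord ?sn.
Qed.

Lemma greedy_output_ordering (R : realFieldType) (n : nat)
    (d : 'I_n -> 'I_n -> R) (s : seq 'I_n) :
  greedy_output d s -> s \in orderings n.
Proof.
case=> run; rewrite -leqNgt mem_orderings => ns.
have [su sn] : uniq s /\ (size s <= n)%N.
  elim: run {ns} => [//|t u _ [tu _] tn ut _].
  by rewrite rcons_uniq ut tu size_rcons.
by rewrite su eqn_leq sn ns.
Qed.

Lemma max_seq_sum_diversity_ge (R : realFieldType) (n : nat)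
    (d : 'I_n -> 'I_n -> R) (p : 'I_n -> R) (O : seq 'I_n) :
  O \in orderings n ->
  seq_sum_diversity d p O <= max_seq_sum_diversity d p.
Proof. by move=> OP; apply: le_bigmax_seq. Qed.

Lemma max_seq_sum_diversity_attained (R : realFieldType) (n : nat)
    (d : 'I_n -> 'I_n -> R) (p : 'I_n -> R) :
  exists2 O, O \in orderings n &
    max_seq_sum_diversity d p = seq_sum_diversity d p O.
Proof.
rewrite /max_seq_sum_diversity big_seq.
elim/big_ind: _ => [|x y [O1 h1 ->] [O2 h2 ->]|O OP]; last by exists O.
  by exists (enum 'I_n); rewrite // mem_permutations.
by rewrite maxEle; case: ifP => _; [exists O2 | exists O1].
Qed.

(* Main.v *)
(** With [p_i = p] the law of the accepted prefix depends only on its length, so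
    it suffices that every greedy prefix [G] has at least half of the diversity
    of any set [T] of the same size [m].  When [|G| = i < m], the triangle
    inequality applied to [T :&: G], [T :\: G] and [G :\: T] shows that the
    average over [v] in [T :\: G] of the total distance from [v] to [G] is at
    least [i / (m (m - 1)) * Div T]; the greedy item gains at least as much, and
    these gains for [i < m] add up to [Div T / 2]. *)
Require Import Defs.
From mathcomp Require Import all_boot all_order all_algebra.
From mathcomp Require Import ring lra.

Set Implicit Arguments.
Unset Strict Implicit.
Unset Printing Implicit Defensive.

Import Order.TTheory GRing.Theory Num.Theory.
Local Open Scope ring_scope.

(** Ordered pairs are summed: for a metric, [cross_sum d A A] is twice [Div d A], and the asymmetric
    condition [i < j] disappears, so the sum splits over disjoint unions. *)
Definition cross_sum (R : realFieldType) (T : finType) (d : T -> T -> R)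
    (A B : {set T}) : R :=
  \sum_(x in A) \sum_(y in B) d x y.

(** * Consequences of the triangle inequality for sums of distances *)

Section CrossSum.
Variables (R : realFieldType) (T : finType) (d : T -> T -> R).
Hypothesis d_metric : is_metric d.
Implicit Types A B C : {set T}.
Local Notation cross := (cross_sum d).

Lemma metric_ge0 x y : 0 <= d x y.
Proof. by case: d_metric. Qed.

Lemma metric_refl x : d x x = 0.
Proof. by case: d_metric => _ /(_ x x) [_ ->]. Qed.

Lemma metric_sym x y : d x y = d y x.
Proof. by case: d_metric. Qed.

Lemma metric_triangle x y z : d x z <= d x y + d y z.
Proof. by case: d_metric. Qed.

Lemma cross_sum_ge0 A B : 0 <= cross A B.
Proof. by do 2!apply: sumr_ge0 => ? _; apply: metric_ge0. Qed.

Lemma cross_sum_sym A B : cross A B = cross B A.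
Proof.
rewrite /cross_sum exchange_big; apply: eq_bigr => x _.
by apply: eq_bigr => y _; apply: metric_sym.
Qed.

Lemma cross_sumUl A B C :
  [disjoint A & B] -> cross (A :|: B) C = cross A C + cross B C.
Proof.
move=> AB; rewrite /cross_sum -bigU //=; by apply: eq_bigl => x; rewrite !inE.
Qed.

Lemma cross_sumUr A B C :
  [disjoint A & B] -> cross C (A :|: B) = cross C A + cross C B.
Proof. by move=> AB; rewrite cross_sum_sym cross_sumUl // !(cross_sum_sym C). Qed.

Lemma cross_sumU A B : [disjoint A & B] ->
  cross (A :|: B) (A :|: B) = cross A A + cross B B + 2 * cross A B.
Proof.
move=> AB; rewrite cross_sumUl // !cross_sumUr // (cross_sum_sym B A); ring.
Qed.

Lemma cross_sum1 x : cross [set x] [set x] = 0.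
Proof. by rewrite /cross_sum !big_set1 metric_refl. Qed.

(** Each distance between distinct points of [A] is routed through every [y] in [B]. A point of [A]
    is the first member of [#|A| - 1] such ordered pairs and the second of as many, whence the
    constant. *)
Lemma cross_sum_triangle A B :
  #|B|%:R * cross A A <= 2 * (#|A|%:R - 1) * cross A B.
Proof.
rewrite (cross_sum_sym A B) [leLHS]mulr_natl -sumr_const [in leRHS]/cross_sum mulr_sumr.
apply: ler_sum => y _.
(* The [#|A| - 1] triangles with [z != x] give as many copies of [d y x]; one of them fills the gap
   at [z = x] in the last sum. *)
have term x : x \in A ->
    \sum_(z in A) d x z <= (#|A|%:R - 2) * d y x + \sum_(z in A) d y z.
  move=> xA; rewrite (bigD1 x) //= metric_refl add0r [in leRHS](bigD1 x) //=.
  apply: (@le_trans _ _ (\sum_(z in A | z != x) (d y x + d y z))).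
    by apply: ler_sum => z _; rewrite (metric_sym y x) metric_triangle.
  rewrite big_split /= sumr_const (cardD1 x A) xA.
  have -> : #|[pred z in A | z != x]| = #|[predD1 A & x]|.
    by apply: eq_card => z; rewrite !inE andbC.
  by rewrite -[_ *+ _]mulr_natl add1n -natr1; lra.
rewrite [leLHS]/cross_sum; apply: (le_trans (ler_sum _ term)).
by rewrite big_split /= -mulr_sumr sumr_const -[_ *+ _]mulr_natl; lra.
Qed.

Lemma cross_sum_average (G O : {set T}) : (#|G| < #|O|)%N ->
  #|G|%:R * #|O :\: G|%:R * cross O O
    <= 2 * (#|O|%:R * (#|O|%:R - 1)) * cross (O :\: G) G.
Proof.
move=> GO; set A := O :&: G; set B := G :\: O; set C := O :\: G.
have dAC : [disjoint A & C].
  rewrite -setI_eq0; apply/eqP/setP => x; rewrite !inE.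
  by case: (x \in G); rewrite /= ?andbF.
have dAB : [disjoint A & B].
  by rewrite -setI_eq0; apply/eqP/setP => x; rewrite !inE; case: (x \in O); rewrite ?andbF.
have OE : O = A :|: C by rewrite setID.
have GE : G = A :|: B by rewrite /A setIC setID.
have cO : #|O| = (#|A| + #|C|)%N by rewrite -(cardsID G).
have cG : #|G| = (#|A| + #|B|)%N by rewrite /A setIC cardsID.
have crossG : cross C G = cross A C + cross B C.
  by rewrite [in LHS]GE cross_sumUr // !(cross_sum_sym C).
have crossO : cross O O = cross A A + cross C C + 2 * cross A C.
  by rewrite [in LHS]OE cross_sumU.
have hAC := cross_sum_triangle A C.
have hCA := cross_sum_triangle C A.
have hCB := cross_sum_triangle C B.
rewrite (cross_sum_sym C A) in hCA; rewrite (cross_sum_sym C B) in hCB.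
rewrite crossG crossO cO cG !natrD.
(* Strictness yields both [c - b >= 0], the sign of a weight in [h1], and [c >= 1]. *)
have bc : (#|B| < #|C|)%N by rewrite -(ltn_add2l #|A|) -cO -cG.
have bcR : #|B|%:R + 1 <= #|C|%:R :> R by rewrite natr1 ler_nat.
have a0 : 0 <= #|A|%:R :> R by [].
have b0 : 0 <= #|B|%:R :> R by [].
have x0 := cross_sum_ge0 A C; have y0 := cross_sum_ge0 B C.
have g0 := cross_sum_ge0 C C.
have c1 : #|C|%:R = 1 :> R -> cross C C = 0.
  by move=> /eqP; rewrite pnatr_eq1 => /cards1P [z ->]; rewrite cross_sum1.
move: (cross A A) (cross A C) (cross B C) (cross C C) hAC hCA hCB x0 y0 g0 c1.
move: (#|A|%:R : R) (#|B|%:R : R) (#|C|%:R : R) a0 b0 bcR.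
move=> a b c a0 b0 {}bc al x y g hAC hCA hCB x0 y0 g0 c1.
(* Bounding [c * al] by [hAC] turns the [al] and [x] terms on the left into
   [2 * (a + b) * (a + c - 1) * x]; moving this to the right leaves [key]. *)
suff key : (a + b) * c * g <= 2 * (a + c - 1) * ((c - b) * x + (a + c) * y).
  have : (a + b) * (c * al) <= (a + b) * (2 * (a - 1) * x).
    by apply: ler_wpM2l => //; lra.
  by move: key; nra.
(* [hCA] and [hCB] carry a factor [c - 1], which is void when [c = 1]. *)
have [ce|cn] := eqVneq c 1.
  have gz := c1 ce; rewrite gz mulr0; apply: mulr_ge0; first lra.
  by apply: addr_ge0; apply: mulr_ge0; lra.
have cgt : 0 < c - 1.
  by rewrite lt_neqAle eq_sym subr_eq0 cn; lra.
rewrite -(ler_pM2l cgt).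
(* Since [a * (c - b) + b * (a + c) = (a + b) * c], the left sides of [h1] and [h2] add up to
   [(a + c - 1) * (a + b) * c * g]. This exceeds the required left side by exactly the quantity in
   [h3]. *)
have h1 : (a + c - 1) * (c - b) * (a * g)
       <= (a + c - 1) * (c - b) * (2 * (c - 1) * x).
  by apply: ler_wpM2l => //; apply: mulr_ge0; lra.
have h2 : (a + c - 1) * (a + c) * (b * g)
       <= (a + c - 1) * (a + c) * (2 * (c - 1) * y).
  by apply: ler_wpM2l => //; apply: mulr_ge0; lra.
have h3 : 0 <= (a + b) * c * g * a by do 3?[apply: mulr_ge0 => //]; lra.
by lra.
Qed.

End CrossSum.

(** * Greedy prefixes compared with arbitrary sets *)

Section Greedy.
Variables (R : realFieldType) (n : nat) (d : 'I_n -> 'I_n -> R).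
Hypothesis d_metric : is_metric d.
Implicit Types (A G O : {set 'I_n}) (s : seq 'I_n).
Local Notation cross := (cross_sum d).

Lemma DivE A : 2 * Div d A = cross A A.
Proof.
have -> : cross A A = Div d A + \sum_(i in A) \sum_(j in A | (j < i)%N) d i j.
  rewrite -big_split; apply: eq_bigr => i iA /=.
  rewrite (bigID (fun j : 'I_n => (i < j)%N)) /=; congr (_ + _).
  rewrite (bigID (fun j : 'I_n => (j < i)%N)) /= [X in _ + X]big1 ?addr0.
    by apply: eq_bigl => j; case: ltngtP; rewrite ?andbF ?andbT.
  move=> j /andP[/andP[_ ij] ji].
  have -> : j = i by apply/val_inj/eqP; rewrite eqn_leq leqNgt ij leqNgt ji.
  exact: metric_refl d_metric i.
rewrite mulr_natl mulr2n; congr (_ + _); rewrite /Div.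
rewrite (exchange_big_dep (mem A)) /=; last by move=> i j _ /andP[].
apply: eq_bigr => i iA; rewrite iA; apply: eq_bigr => j _.
exact: metric_sym d_metric j i.
Qed.

Lemma DivU1 A u : u \notin A -> Div d (u |: A) = Div d A + cross [set u] A.
Proof.
move=> uA; have dis : [disjoint [set u] & A] by rewrite disjoints1.
have := DivE (u |: A); rewrite cross_sumU // cross_sum1 // -DivE; lra.
Qed.

Lemma Div_ge0 A : 0 <= Div d A.
Proof. by have := cross_sum_ge0 d_metric A A; rewrite -DivE; lra. Qed.

Lemma greedy_run_uniq s : greedy_run d s -> uniq s.
Proof. by elim=> // t u _ tu _ ut _; rewrite rcons_uniq ut. Qed.

Lemma greedy_run_take s k : greedy_run d s -> greedy_run d (take k s).
Proof.
elim=> [|t u run IH tn ut umax]; first exact: greedy_start.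
have [kt|tk] := leqP k (size t); first by rewrite -cats1 takel_cat.
by rewrite take_oversize ?size_rcons //; apply: greedy_append.
Qed.

(** The maximal gain is at least the average gain over [O :\: G], which [cross_sum_average] bounds
    from below. *)
Lemma greedy_gain G O u : (#|G| < #|O|)%N -> u \notin G ->
    (forall v, v \notin G -> Div d (v |: G) <= Div d (u |: G)) ->
  #|G|%:R * Div d O <= #|O|%:R * (#|O|%:R - 1) * cross [set u] G.
Proof.
move=> GO uG umax; set C := O :\: G.
have C0 : (0 < #|C|)%N.
  rewrite card_gt0; apply: contraTneq GO => /eqP; rewrite setD_eq0 => /subset_leq_card.
  by rewrite -leqNgt.
have gain : cross C G <= #|C|%:R * cross [set u] G.
  rewrite mulr_natl -sumr_const; apply: ler_sum => v; rewrite inE => /andP[vG _].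
  have := umax v vG; rewrite !DivU1 // lerD2l; apply: le_trans.
  by rewrite /cross_sum big_set1.
have O1 : 1 <= #|O|%:R :> R by rewrite ler1n (leq_trans _ GO).
have := cross_sum_average d_metric GO; rewrite -DivE -/C => avg.
have C0R : 0 < #|C|%:R :> R by rewrite ltr0n.
rewrite -(ler_pM2l C0R).
have : #|O|%:R * (#|O|%:R - 1) * cross C G
    <= #|O|%:R * (#|O|%:R - 1) * (#|C|%:R * cross [set u] G).
  by apply: ler_wpM2l => //; apply: mulr_ge0; lra.
lra.
Qed.

(** The gains telescope, as [(i + 1) * i - i * (i - 1) = 2 * i]. The set [O] may be larger than the
    run so that it stays fixed during the induction. *)
Lemma greedy_run_Div s O : greedy_run d s -> (size s <= #|O|)%N ->
  (size s)%:R * ((size s)%:R - 1) * Div d O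
    <= 2 * (#|O|%:R * (#|O|%:R - 1)) * Div d [set i in s].
Proof.
elim=> [_|t u run IH tn ut umax].
  rewrite !mul0r; apply: mulr_ge0; last exact: Div_ge0.
  case: (#|O|) => [|m]; first by rewrite mul0r mulr0.
  by rewrite -[m.+1%:R]natr1 addrK !mulr_ge0 // natr1.
rewrite size_rcons => tO.
have cG : #|[set i in t]| = size t by rewrite cardsE; apply/card_uniqP/greedy_run_uniq.
have uG : u \notin [set i in t] by rewrite inE.
have := IH (ltnW tO).
have := @greedy_gain [set i in t] O u; rewrite cG => /(_ tO uG) gain.
have {gain} : (size t)%:R * Div d O
    <= #|O|%:R * (#|O|%:R - 1) * cross [set u] [set i in t].
  by apply: gain => v; rewrite inE; apply: umax.
have -> : [set i in rcons t u] = u |: [set i in t].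
  by apply/setP => v; rewrite !inE mem_rcons inE.
by rewrite DivU1 // -natr1; lra.
Qed.

Lemma Div_card_le1 A : (#|A| <= 1)%N -> Div d A = 0.
Proof.
move=> A1; have := DivE A.
have [->|[x ->]] : A = set0 \/ exists x, A = [set x].
  case: (set_0Vmem A) => [->|[x xA]]; [by left | right; exists x].
  by apply/eqP; rewrite eq_sym eqEcard sub1set xA cards1.
- by rewrite /cross_sum !big_set0; lra.
- by rewrite cross_sum1 //; lra.
Qed.

Lemma greedy_run_half s O : greedy_run d s -> #|O| = size s ->
  2^-1 * Div d O <= Div d [set i in s].
Proof.
(* For size at most 1 the factor to be cancelled vanishes, but then so does [Div d O]. *)
move=> run cO; have [s1|s1] := leqP (size s) 1.
  by rewrite Div_card_le1 ?cO // mulr0; apply: Div_ge0.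
have := greedy_run_Div run (O := O); rewrite cO => /(_ (leqnn _)).
have h : 0 < (size s)%:R * ((size s)%:R - 1) :> R.
  by rewrite mulr_gt0 ?subr_gt0 ?ltr1n ?ltr0n // ltnW.
by move=> half; rewrite -(ler_pM2l h); lra.
Qed.

Lemma prefix_prob_unif (p : R) (q : 'I_n -> R) s k : (forall i, q i = p) ->
    (k <= size s)%N ->
  prefix_prob q s k = p ^+ k * (if (k < size s)%N then 1 - p else 1).
Proof.
move=> qp ks; rewrite /prefix_prob; congr (_ * _).
  rewrite (eq_bigr (fun=> p)) // big_const_seq count_predT size_takel //.
  by rewrite -Monoid.iteropE.
have := size_drop k s; case: (drop k s) => [|j t] /= h.
  by rewrite -subn_gt0 -h.
by rewrite qp -subn_gt0 -h.
Qed.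

End Greedy.

Theorem theorem8p1 (R : realFieldType) (n : nat) (d : 'I_n -> 'I_n -> R)
    (p : R) (q : 'I_n -> R) (S : seq 'I_n)
    (d_metric : is_metric d)
    (p01 : 0 <= p <= 1)
    (q_unif : forall i, q i = p)
    (S_greedy : greedy_output d S) :
  seq_sum_diversity d q S >= 2^-1 * max_seq_sum_diversity d q.
Proof.
have /andP[p0 p1] := p01.
have [O] := max_seq_sum_diversity_attained d q.
rewrite mem_orderings => /andP[uO /eqP sO] ->.
have := greedy_output_ordering S_greedy.
rewrite mem_orderings => /andP[uS /eqP sS]; case: S_greedy => run _.
rewrite /seq_sum_diversity sO sS mulr_sumr; apply: ler_sum => -[k /=].
rewrite ltnS => kn _.
(* Length [k] has the same nonnegative probability under both orderings, so only the diversities of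
   the two prefixes remain to be compared. *)
rewrite !(prefix_prob_unif q_unif) ?sO ?sS // mulrCA.
apply: ler_wpM2l.
  by apply: mulr_ge0; [apply: exprn_ge0 | case: ifP => _ //; rewrite subr_ge0].
apply: greedy_run_half => //; first exact: greedy_run_take.
by rewrite cardsE (card_uniqP _) ?take_uniq // !size_takel ?sO ?sS.
Qed.
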